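(* Let $\Gamma$ be a group, $n\ge1$ an integer, $f\colon\Gamma\to\mathrm{Sym}(n)$ a function, and $\Delta\lhd\Gamma$ a normal subgroup such that $\Gamma/\Delta$ is a discrete amenable group. Write $\delta_\infty=\mathrm{def}_\infty(f)$ and $\delta_\Delta=\sup\{d^H(f(\gamma),\mathrm{id}) : \gamma\in\Delta\}$. Then there are an integer $N$ with $n\le N\le(1+2436\,\delta_\infty+1218\,\delta_\Delta)\,n$ and a group homomorphism $h\colon\Gamma\to\mathrm{Sym}(N)$ such that $d_\infty(h,f)\le4079\,\delta_\infty+2040\,\delta_\Delta$.
   Context: Write $[n]=\{1,\dots,n\}$. For integers $1\le n\le N$, $\sigma\in\mathrm{Sym}(n)$ and $\tau\in\mathrm{Sym}(N)$, put $d^H(\sigma,\tau)=d^H(\tau,\sigma)=\frac1N\left(|\{x\in[n] : \sigma(x)\ne\tau(x)\}|+(N-n)\right)$. For functions $f\colon\Gamma\to\mathrm{Sym}(n)$ and $h\colon\Gamma\to\mathrm{Sym}(N)$: $\mathrm{def}_\infty(f)=\sup\{d^H(f(\gamma_1\gamma_2),f(\gamma_1)f(\gamma_2)) : \gamma_1,\gamma_2\in\Gamma\}$ and $d_\infty(f,h)=d_\infty(h,f)=\sup\{d^H(f(\gamma),h(\gamma)) : \gamma\in\Gamma\}$. A discrete group is amenable if it admits a left-invariant finitely additive probability measure defined on all its subsets. *)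

(* Defs.v *)
From HB Require Import structures.
From mathcomp Require Import all_boot all_order all_algebra all_fingroup.
From mathcomp Require Import generic_quotient.
From mathcomp Require Import mathcomp_extra boolp classical_sets reals.

Set Implicit Arguments.
Unset Strict Implicit.
Unset Printing Implicit Defensive.

Import Order.TTheory GRing.Theory Num.Theory.
Local Open Scope classical_set_scope.
Local Open Scope ring_scope.

Definition normal_subgroup (G : groupType) (D : {pred G}) : Prop :=
  group_closed D /\ forall x y : G, x \in D -> (x ^ y)%g \in D.

Section FactorGroup.
Variables (G : groupType) (D : {pred G}) (nD : normal_subgroup D).
Local Open Scope group_scope.
Local Open Scope quotient_scope.

Definition coset_rel (x y : G) : bool := x^-1 * y \in D.

Lemma coset_rel_equiv : equiv_class_of coset_rel.
Proof.
have [gD _] := nD; have [D1 _] := gD.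
have DV := group_closedV gD; have DM := group_closedM gD.
split=> [x|x y|y x z]; rewrite /coset_rel ?mulVg //.
  by apply/idP/idP => /DV; rewrite invgM invgK.
by move=> xy yz; have := DM _ _ xy yz; rewrite mulgA mulgK.
Qed.

Canonical coset_equiv := EquivRelPack coset_rel_equiv.

Definition factor_group := {eq_quot coset_equiv}.

HB.instance Definition _ := Choice.copy factor_group {eq_quot coset_equiv}.
HB.instance Definition _ := EqQuotient.copy factor_group {eq_quot coset_equiv}.

Local Notation cl := (\pi_factor_group).

Lemma eq_factorP (x y : G) : reflect (cl x = cl y) (coset_rel x y).
Proof. exact: (@eqquotP _ _ factor_group). Qed.

Definition factor_one : factor_group := cl 1.
Definition factor_mul (a b : factor_group) : factor_group :=
  cl (repr a * repr b).
Definition factor_inv (a : factor_group) : factor_group :=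
  cl (repr a)^-1.

Lemma repr_factor (x : G) : coset_rel (repr (cl x)) x.
Proof. by apply/eq_factorP; rewrite reprK. Qed.

Lemma factor_mulE (x y : G) : factor_mul (cl x) (cl y) = cl (x * y).
Proof.
have [gD nJ] := nD; have DM := group_closedM gD.
apply/eq_factorP; move: (repr_factor x) (repr_factor y).
set x' := repr (cl x); set y' := repr (cl y); rewrite /coset_rel => hx hy.
have := DM _ _ (nJ _ y' hx) hy.
by rewrite /conjg invgM !mulgA mulgK.
Qed.

Lemma factor_invE (x : G) : factor_inv (cl x) = cl x^-1.
Proof.
have [gD nJ] := nD; have DV := group_closedV gD.
apply/eq_factorP; have := repr_factor x.
set x' := repr (cl x); rewrite /coset_rel invgK => hx.
have := nJ _ x'^-1 (DV _ hx).
by rewrite /conjg invgM !invgK !mulgA mulgK.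
Qed.

Lemma factor_mulA : associative factor_mul.
Proof.
elim/quotW=> x; elim/quotW=> y; elim/quotW=> z.
rewrite (factor_mulE y z) (factor_mulE x (y * z)).
by rewrite (factor_mulE x y) (factor_mulE (x * y) z) mulgA.
Qed.

Lemma factor_mul1g : left_id factor_one factor_mul.
Proof. by elim/quotW=> x; rewrite (factor_mulE 1 x) mul1g. Qed.

Lemma factor_mulg1 : right_id factor_one factor_mul.
Proof. by elim/quotW=> x; rewrite (factor_mulE x 1) mulg1. Qed.

Lemma factor_mulVg : left_inverse factor_one factor_inv factor_mul.
Proof.
by elim/quotW=> x; rewrite (factor_invE x) (factor_mulE x^-1 x) mulVg.
Qed.

Lemma factor_mulgV : right_inverse factor_one factor_inv factor_mul.
Proof.
by elim/quotW=> x; rewrite (factor_invE x) (factor_mulE x x^-1) mulgV.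
Qed.

HB.instance Definition _ := isGroup.Build factor_group
  factor_mulA factor_mul1g factor_mulg1 factor_mulVg factor_mulgV.

End FactorGroup.

Definition amenable (R : realType) (G : groupType) : Prop :=
  exists mu : set G -> R,
    [/\ forall A, 0 <= mu A,
        mu [set: G] = 1,
        forall A B, A `&` B = set0 -> mu (A `|` B) = mu A + mu B &
        forall (g : G) A, mu [set (g * x)%g | x in A] = mu A].

(* The product of {perm _} applies its left factor first; products in Sym(n)
   are composed here as functions, right factor first. *)
Definition perm_comp (T : finType) (s t : {perm T}) : {perm T} := (t * s)%g.

Lemma perm_compE (T : finType) (s t : {perm T}) x :
  perm_comp s t x = s (t x).
Proof. exact: permM. Qed.

Section Hamming.
Variable R : realType.

(* d^H(s, t) for n <= N; it stands for d^H(t, s) as well, and likewise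
   for d_infty. *)
Definition dH (n N : nat) (le_nN : (n <= N)%N) (s : 'S_n) (t : 'S_N) : R :=
  N%:R^-1 *
  (#|[pred x : 'I_n | widen_ord le_nN (s x) != t (widen_ord le_nN x)]|%:R
   + (N - n)%:R).

Definition def_infty (G : groupType) (n : nat) (f : G -> 'S_n) : R :=
  sup [set dH (leqnn n) (f (p.1 * p.2)%g) (perm_comp (f p.1) (f p.2))
      | p in [set: G * G]].

Definition d_infty (G : groupType) (n N : nat) (le_nN : (n <= N)%N)
    (f : G -> 'S_n) (h : G -> 'S_N) : R :=
  sup [set dH le_nN (f g) (h g) | g in [set: G]].

Definition dist_id_on (G : groupType) (D : {pred G}) (n : nat)
    (f : G -> 'S_n) : R :=
  sup [set dH (leqnn n) (f g) 1%g | g in [set` D]].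

End Hamming.

(* Main.v *)
(* Pulling back a map on Gamma/Delta along coset representatives reduces to the
   case Delta = 1, where Gamma = G carries a right-invariant mean nu. G acts by
   translation on functions G -> [n], preserving the pseudometric
   d(phi, psi) = nu {phi <> psi}. The slices L_x : y |-> f(y)(x) are pairwise at
   distance 1 because every f(y) is a permutation, and the translate g.L_x is
   close to L_(f(g)x) for most x because f is almost multiplicative. Call phi
   good if more than half of its translates are close to some slice: goodness is
   translation invariant, distances between good functions are either small or
   close to 1, and so "being close" is an invariant equivalence relation on good
   functions. Double counting bounds the number of its classes by (1 + O(delta))n,
   and the action of G on the classes, relabelled so that the class of L_x gets
   label x, is the required homomorphism. *)

Require Import Defs.
From mathcomp Require Import all_boot all_order all_algebra all_fingroup.
From mathcomp Require Import generic_quotient.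
From mathcomp Require Import mathcomp_extra boolp classical_sets reals.
From mathcomp Require Import lra.

Local Open Scope ring_scope.

Import Order.TTheory GRing.Theory Num.Theory.

Set Implicit Arguments.
Unset Strict Implicit.
Unset Printing Implicit Defensive.

(** * Invariant means and averaging of finite counts *)

Definition right_invariant_mean (R : realType) (G : groupType)
    (nu : set G -> R) : Prop :=
  [/\ forall A, 0 <= nu A,
      nu setT = 1,
      forall A B, (A `&` B = set0)%classic ->
        nu (A `|` B)%classic = nu A + nu B &
      forall h A, nu [set g | A (g * h)%g]%classic = nu A].

(** Inversion exchanges left and right translations, so the mean is transported along it. *)
Lemma amenable_right_invariant_mean (R : realType) (G : groupType) :
  amenable R G -> exists nu : set G -> R, right_invariant_mean nu.
Proof.
case=> mu [mu0 muT muU muM].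
exists (fun A => mu [set g | A g^-1%g]%classic); split=> //.
- move=> A B AB; rewrite -muU //.
  apply/seteqP; split=> g //= [Ag Bg].
  by have : (A `&` B)%classic g^-1%g by []; rewrite AB.
- move=> h A; rewrite -[RHS](muM h); congr mu.
  apply/seteqP; split=> g /=.
    move=> Ag; exists (h^-1 * g)%g; last by rewrite mulKVg.
    by rewrite /= invgM invgK.
  by case=> x /= Ax <-; rewrite invgM mulgKV.
Qed.

Section Mean.
Variables (R : realType) (G : groupType) (nu : set G -> R).
Hypothesis nuP : right_invariant_mean nu.
Local Open Scope classical_set_scope.

Lemma mean_ge0 A : 0 <= nu A. Proof. by case: nuP. Qed.

Lemma meanT : nu setT = 1. Proof. by case: nuP. Qed.

Lemma meanU A B : A `&` B = set0 -> nu (A `|` B) = nu A + nu B.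
Proof. by case: nuP => _ _ + _; apply. Qed.

Lemma mean_translate h A : nu [set g | A (g * h)%g] = nu A.
Proof. by case: nuP => _ _ _; apply. Qed.

Lemma mean0 : nu set0 = 0.
Proof.
by have := meanU (set0I set0); rewrite set0U; move: (nu set0) => x; lra.
Qed.

Lemma meanD A B : nu A = nu (A `&` B) + nu (A `&` ~` B).
Proof.
by rewrite -meanU -?setIUr ?setUv ?setIT // setIACA setICr setI0.
Qed.

Lemma le_mean A B : A `<=` B -> nu A <= nu B.
Proof.
by move=> AB; rewrite (meanD B A) (setIidr AB) lerDl mean_ge0.
Qed.

Lemma meanC A : nu (~` A) = 1 - nu A.
Proof. by have := meanD setT A; rewrite !setTI meanT; lra. Qed.

Lemma le_meanU A B : nu (A `|` B) <= nu A + nu B.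
Proof.
rewrite (meanD (A `|` B) A) setIUl setIid setIUl setICr set0U.
by apply: lerD; apply: le_mean => x; [case=> // -[] | case].
Qed.

Lemma mean_gt_half_meet A B :
  1 / 2 < nu A -> 1 / 2 < nu B -> exists g, A g /\ B g.
Proof.
move=> hA hB; apply: contrapT => nAB.
have AB : A `&` B = set0.
  by apply/seteqP; split=> g //= [Ag Bg]; apply: nAB; exists g.
by have := le_mean (@subsetT _ (A `|` B)); rewrite meanT meanU //; lra.
Qed.

Lemma mean_fibers (S : finType) (p : G -> S) A :
  nu A = \sum_(s : S) nu (A `&` [set g | p g = s]).
Proof.
suff H (r : seq S) : uniq r ->
    nu (A `&` [set g | p g \in r]) = \sum_(s <- r) nu (A `&` [set g | p g = s]).
  rewrite -H ?index_enum_uniq //; congr nu.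
  by apply/seteqP; split=> g //= Ag; [split=> //; rewrite mem_index_enum | case: Ag].
elim: r => [_|s r IHr /= /andP[sr ur]].
  by rewrite big_nil -[RHS]mean0; congr nu; apply/seteqP; split=> g //= [].
rewrite big_cons -IHr // -meanU; last first.
  by apply/seteqP; split=> g //= [[_ ->] [_]]; rewrite (negPf sr).
congr nu; apply/seteqP; split=> g /=; rewrite in_cons.
  by case=> Ag /orP[/eqP|]; [left|right].
by case=> -[Ag]; [move=> ->; rewrite eqxx | move=> ->; rewrite orbT].
Qed.

(** This integrates a pointwise bound against a mean that is only finitely additive: as g varies,
    the set of t with [A t g] takes finitely many values, and the bound is averaged over the fibers
    of this pattern. *)
Lemma mean_double_count (T : finType) (A : T -> set G) (w : T -> R) (c : R) :
  (forall g, \sum_(t | `[< A t g >]) w t <= c) -> \sum_t w t * nu (A t) <= c.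
Proof.
move=> hc; pose p g := [set t | `[< A t g >]]%SET.
have nuA t : nu (A t) = \sum_(s : {set T}) (t \in s)%:R * nu [set g | p g = s].
  rewrite (mean_fibers p); apply: eq_bigr => s _; case: (boolP (t \in s)) => ts.
    rewrite mul1r; congr nu; apply/seteqP; split=> g /=; first by case.
    by move=> ps; split=> //; move: ts; rewrite -ps inE => /asboolP.
  rewrite mul0r -[RHS]mean0; congr nu; apply/seteqP; split=> g //= [At ps].
  by move: ts; rewrite -ps inE; case/asboolP.
under eq_bigr => t _ do rewrite nuA mulr_sumr.
rewrite exchange_big /=.
have -> : c = \sum_(s : {set T}) c * nu [set g | p g = s].
  rewrite -mulr_sumr -[LHS]mulr1 -meanT (mean_fibers p); congr (_ * _).
  by apply: eq_bigr => s _; rewrite setTI.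
apply: ler_sum => s _.
(* The pointwise bound is available only for patterns that some g realizes; the fiber of any other
   pattern is empty. *)
case: (pselect (exists g, p g = s)) => [[g ps]|nos]; last first.
  rewrite (_ : [set g | p g = s] = set0) ?mean0.
    by rewrite mulr0 big1 // => t _; rewrite !mulr0.
  by apply/seteqP; split=> g //= ps; apply: nos; exists g.
under eq_bigr => t _ do rewrite mulrA.
rewrite -mulr_suml ler_wpM2r ?mean_ge0 //; apply: le_trans (hc g).
rewrite [leRHS]big_mkcond /= le_eqVlt; apply/orP; left; apply/eqP.
apply: eq_bigr => t _; rewrite -ps inE.
by case: asboolP; rewrite ?mulr1 ?mulr0.
Qed.

End Mean.

Lemma ler_sum_inj (R : realType) (I T : finType) (P : pred I) (v : I -> T)
    (w : I -> R) (b : T -> R) :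
  {in P &, injective v} -> (forall i, P i -> w i <= b (v i)) ->
  (forall t, 0 <= b t) -> \sum_(i | P i) w i <= \sum_t b t.
Proof.
move=> vinj wb b0; apply: le_trans (ler_sum _ wb) _.
rewrite -(big_imset b vinj) /= [leRHS](bigID (mem (v @: P))) /=.
by rewrite lerDl sumr_ge0.
Qed.

(** * The translation action on functions and its invariant pseudometric *)

Section Translates.
Variables (R : realType) (G : groupType) (nu : set G -> R) (T : eqType).
Hypothesis nuP : right_invariant_mean nu.
Implicit Types (phi psi : G -> T) (g : G).
Local Open Scope classical_set_scope.

(** Multiplying the argument on the right gives a left action, which is isometric because the mean
    is right invariant. *)
Definition translate g phi : G -> T := fun y => phi (y * g)%g.

Lemma translateM a b phi :
  translate (a * b)%g phi = translate a (translate b phi).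
Proof. by apply/funext => y; rewrite /translate mulgA. Qed.

Lemma translate1 phi : translate 1%g phi = phi.
Proof. by apply/funext => y; rewrite /translate mulg1. Qed.

Definition mean_dist phi psi : R := nu [set y | phi y != psi y].

Lemma mean_dist_ge0 phi psi : 0 <= mean_dist phi psi.
Proof. exact: mean_ge0. Qed.

Lemma mean_distxx phi : mean_dist phi phi = 0.
Proof.
by rewrite -(mean0 nuP); congr nu; apply/seteqP; split=> y //=; rewrite eqxx.
Qed.

Lemma mean_distC phi psi : mean_dist phi psi = mean_dist psi phi.
Proof. by congr nu; apply/seteqP; split=> y /=; rewrite eq_sym. Qed.

Lemma mean_dist_triangle psi phi chi :
  mean_dist phi chi <= mean_dist phi psi + mean_dist psi chi.
Proof.
apply: le_trans (le_meanU nuP _ _); apply: le_mean => // y /=.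
by case: (eqVneq (phi y) (psi y)) => [->|]; [right|left].
Qed.

Lemma mean_dist_translate g phi psi :
  mean_dist (translate g phi) (translate g psi) = mean_dist phi psi.
Proof. exact: (mean_translate nuP g [set y | phi y != psi y]). Qed.

End Translates.

(** * Good functions, their clusters, and the action on clusters *)

Section Clusters.
Variables (R : realType) (G : groupType) (nu : set G -> R).
Hypothesis nuP : right_invariant_mean nu.
Variables (n : nat) (n_gt0 : (0 < n)%N) (f : G -> 'S_n) (c : R).
Hypothesis defect_le : forall a b,
  #|[pred x | f (a * b)%g x != f a (f b x)]|%:R <= c.
Implicit Types (phi psi : G -> 'I_n) (g : G) (x : 'I_n).
Local Open Scope classical_set_scope.
Local Notation dist := (mean_dist nu).

Definition slice x : G -> 'I_n := fun y => f y x.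

Definition near_slice (r : R) phi : Prop := exists x, dist phi (slice x) < r.

Definition bad_set x : set G :=
  [set g | 1 / 6 <= dist (translate g (slice x)) (slice (f g x))].

(** The threshold 1/2 ensures that, for two good functions, one common g brings both translates near
    slices. *)
Definition good phi : Prop :=
  1 / 2 < nu [set g | near_slice (1 / 6) (translate g phi)].

Lemma dist_slice x y : x != y -> dist (slice x) (slice y) = 1.
Proof.
move=> xy; rewrite -(meanT nuP); congr nu; apply/seteqP; split=> z //= _.
by rewrite (inj_eq perm_inj).
Qed.

(** Distinct slices are at distance 1, while the path through phi and psi is strictly shorter than
    1. *)
Lemma slice_uniq (r s : R) phi psi x : r + s + dist phi psi <= 1 ->
  forall y, dist phi (slice x) < r -> dist psi (slice y) < s -> x = y.
Proof.
move=> rs y hx hy; apply/eqP; case: eqP => // /eqP /dist_slice xy.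
have := mean_dist_triangle nuP phi (slice x) (slice y).
have := mean_dist_triangle nuP psi phi (slice y).
by rewrite xy (mean_distC _ (slice x)); lra.
Qed.

(** At a point y the two functions compared by [bad_set] take the values [f (y * g) x] and
    [f y (f g x)], so the defect bounds the number of disagreeing x. Averaging over y bounds the sum
    of the distances by c, and Markov's inequality at level 1/6 gives 6c. *)
Lemma card_bad_set g : #|[pred x | `[< bad_set x g >]]|%:R <= 6 * c.
Proof.
have : \sum_x dist (translate g (slice x)) (slice (f g x)) <= c.
  under eq_bigr => x _ do rewrite -[dist _ _]mul1r.
  apply: mean_double_count => // y; apply: le_trans (defect_le y g).
  rewrite sumr_const ler_nat; apply: subset_leq_card; apply/fintype.subsetP => x.
  by rewrite !unfold_in => /asboolP.
rewrite -sumr_const.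
have : \sum_(x in [pred x | `[< bad_set x g >]]) 1 <=
  6 * \sum_x dist (translate g (slice x)) (slice (f g x)).
  rewrite mulr_sumr [leLHS]big_mkcond /=; apply: ler_sum => x _.
  have := mean_dist_ge0 nuP (translate g (slice x)) (slice (f g x)).
  by case: ifPn => [|_]; [rewrite unfold_in => /asboolP; rewrite /bad_set /=|]; lra.
by lra.
Qed.

Lemma sum_bad_set : \sum_x nu (bad_set x) <= 6 * c.
Proof.
under eq_bigr => x _ do rewrite -[nu _]mul1r.
by apply: mean_double_count => // g; rewrite sumr_const; exact: card_bad_set.
Qed.

Lemma card_bad : #|[pred x | 1 / 2 <= nu (bad_set x)]|%:R <= 12 * c.
Proof.
have := sum_bad_set; rewrite -sumr_const.
have : \sum_(x in [pred x | 1 / 2 <= nu (bad_set x)]) 1 <=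
  2 * \sum_x nu (bad_set x).
  rewrite mulr_sumr [leLHS]big_mkcond /=; apply: ler_sum => x _.
  by have := mean_ge0 nuP (bad_set x); case: ifPn => //; rewrite ?unfold_in /=; lra.
by lra.
Qed.

Lemma near_sliceN_bad_set x g phi : dist phi (slice x) < 1 / 6 ->
  ~ bad_set x g -> near_slice (1 / 3) (translate g phi).
Proof.
move=> hx /negP; rewrite -ltNge => hg; exists (f g x).
have := mean_dist_triangle nuP (translate g (slice x)) (translate g phi)
  (slice (f g x)).
by rewrite (mean_dist_translate nuP); lra.
Qed.

Lemma good_slice x : nu (bad_set x) < 1 / 2 -> good (slice x).
Proof.
move=> hx; rewrite /good.
suff /(le_mean nuP) :
    ~` bad_set x `<=` [set g | near_slice (1/6) (translate g (slice x))].
  by rewrite (meanC nuP); lra.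
by move=> g /= /negP; rewrite -ltNge => hg; exists (f g x).
Qed.

Lemma good_translate g phi : good phi -> good (translate g phi).
Proof.
rewrite /good -(mean_translate nuP g); congr (_ < nu _).
by apply/seteqP; split=> z /=; rewrite translateM.
Qed.

(* Distances between good functions avoid [1/3, 2/3], since two good functions
   are simultaneously close to translates of slices. *)
Lemma good_dist_gap phi psi : good phi -> good psi ->
  dist phi psi <= 2 / 3 -> dist phi psi < 1 / 3.
Proof.
move=> gphi gpsi; have [g [[x hx] [y hy]]] := mean_gt_half_meet nuP gphi gpsi.
rewrite -(mean_dist_translate nuP g) => h.
(* The radii are tuned for this: 1/6 + 1/6 + 2/3 = 1. *)
have xy : x = y by apply: (slice_uniq _ hx hy); lra.
have := mean_dist_triangle nuP (slice x) (translate g phi) (translate g psi).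
by rewrite {2}xy (mean_distC _ (slice _) (translate g psi)); lra.
Qed.

Definition separated k (phi : 'I_k -> G -> 'I_n) : Prop :=
  (forall i, good (phi i)) /\ (forall i j, dist (phi i) (phi j) < 1 / 3 -> i = j).

(* Doubling the radius from 1/6 to 1/3 keeps the slices near distinct members
   of the family distinct, while the members that are 1/6-close to a slice lose
   at most the weight of its bad set. *)
Lemma card_separated k (phi : 'I_k -> G -> 'I_n) :
  separated phi -> k%:R <= n%:R + 12 * c.
Proof.
move=> [gphi sphi].
pose K i := [set g | near_slice (1 / 3) (translate g (phi i))].
pose K' i := [set g | near_slice (1 / 6) (translate g (phi i))].
have slice_inj g i j x : dist (translate g (phi i)) (slice x) < 1 / 3 ->
    dist (translate g (phi j)) (slice x) < 1 / 3 -> i = j.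
  move=> hi hj; apply: sphi; apply: good_dist_gap => //.
  rewrite -(mean_dist_translate nuP g).
  have := mean_dist_triangle nuP (slice x) (translate g (phi i)) (translate g (phi j)).
  by rewrite (mean_distC _ (slice _) (translate g (phi j))); lra.
have choice_near r g (S : 'I_k -> set G) :
    (forall i, S i g -> near_slice r (translate g (phi i))) ->
    exists v : 'I_k -> 'I_n,
      forall i, S i g -> dist (translate g (phi i)) (slice (v i)) < r.
  move=> hS; suff /choice[v hv] : forall i, exists x, S i g ->
    dist (translate g (phi i)) (slice x) < r by exists v.
  move=> i; have [/hS [x hx]|nS] := pselect (S i g); first by exists x.
  by exists (Ordinal n_gt0).
have sumK : \sum_i nu (K i) <= n%:R.
  under eq_bigr => i _ do rewrite -[nu _]mul1r.
  apply: mean_double_count => // g.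
  have [v hv] := choice_near _ g K (fun i Ki => Ki).
  have -> : n%:R = \sum_(x : 'I_n) 1 :> R by rewrite sumr_const card_ord.
  apply: (ler_sum_inj (v := v)) => // i j /asboolP /hv hi /asboolP /hv hj vij.
  by apply: (slice_inj g _ _ (v i)) => //; rewrite vij.
(* For fixed g, the indices with g in [K' i] have distinct nearby slices, and if z is outside the
   bad set of the slice near [translate g (phi i)], then z * g lies in [K i]. Hence the weights are
   dominated by the measures of distinct bad sets. *)
have sumK' : \sum_i (1 - nu (K i)) * nu (K' i) <= 6 * c.
  apply: mean_double_count => // g; apply: le_trans sum_bad_set.
  have [v hv] := choice_near _ g K' (fun i Ki => Ki).
  apply: (ler_sum_inj (v := v)) => [i j /asboolP /hv hi /asboolP /hv hj vij|i|x].
  - by apply: (slice_inj g _ _ (v i)); [|rewrite vij]; lra.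
  - move=> /asboolP /hv hi; rewrite -(meanC nuP) -(mean_translate nuP g).
    apply: le_mean => // z /= nKz; apply: contrapT => nbad; apply: nKz.
    by rewrite /K /= translateM; exact: near_sliceN_bad_set nbad.
  - exact: mean_ge0.
(* Termwise, 1 <= K + 2 (1 - K) K', since K <= 1 and goodness says K' > 1/2. The factor 2 turns 6c
   into 12c. *)
suff : k%:R <= \sum_i nu (K i) + 2 * \sum_i (1 - nu (K i)) * nu (K' i) by lra.
rewrite mulr_sumr -big_split /=.
have -> : k%:R = \sum_(i < k) 1 :> R by rewrite sumr_const card_ord.
apply: ler_sum => i _.
have K1 : nu (K i) <= 1 by rewrite -(meanT nuP); exact: le_mean.
have := gphi i; rewrite /good -/(K' i) => K2; nra.
Qed.

(** The bound of [card_separated] provides a family of maximal size; a good function far from all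
    its members could be adjoined to it. *)
Lemma exists_maximal_separated : exists k (phi : 'I_k -> G -> 'I_n),
  separated phi /\ forall psi, good psi -> exists i, dist psi (phi i) < 1 / 3.
Proof.
pose p k := `[< exists phi : 'I_k -> G -> 'I_n, separated phi >].
have p0 : exists k, p k.
  exists 0%N; apply/asboolP; have phi0 (i : 'I_0) : G -> 'I_n by case: i.
  by exists phi0; split=> -[].
have pb k : p k -> (k <= Num.bound `|n%:R + 12 * c|%R)%N.
  case/asboolP => phi /card_separated hk; rewrite -(ler_nat R) ltW //.
  by apply: le_lt_trans (le_trans hk (ler_norm _)) _; exact: archi_boundP.
case: (ex_maxnP p0 pb) => k /asboolP[phi [gphi sphi]] kmax.
exists k, phi; split=> // psi gpsi; apply: contrapT => npsi.
suff /asboolP /kmax : exists phi : 'I_k.+1 -> G -> 'I_n, separated phi by rewrite ltnn.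
exists (fun i => if unlift ord0 i is Some j then phi j else psi).
split=> [i|i j]; first by case: unliftP.
case: (unliftP ord0 i) => [i'|] ->; case: (unliftP ord0 j) => [j'|] -> //.
- by move=> /sphi ->.
- by rewrite (mean_distC nu) => h; case: npsi; exists i'.
- by move=> h; case: npsi; exists j'.
Qed.

(** The indices below k are the clusters, a is translation of clusters, and v sends x to the cluster
    of its slice, with [None] when there is none. *)
Lemma exists_approximating_action :
  exists (k : nat) (a : G -> 'I_k -> 'I_k) (v : 'I_n -> option 'I_k),
  [/\ k%:R <= n%:R + 12 * c,
      a 1%g =1 id /\ (forall g h, a (g * h)%g =1 a g \o a h),
      forall x y i, v x = Some i -> v y = Some i -> x = y &
      forall g, #|[pred x | if v x is Some i then v (f g x) != Some (a g i)
                            else true]|%:R <= 30 * c].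
Proof.
have [k [phi [sphi phiP]]] := exists_maximal_separated.
have [gphi phi_inj] := sphi.
(* Here and in [good_trans], two distances below 1/3 add up to less than 2/3, and the gap brings
   this back below 1/3: closeness is transitive. *)
have eq_class psi i j : dist psi (phi i) < 1 / 3 -> dist psi (phi j) < 1 / 3 -> i = j.
  move=> hi hj; apply: phi_inj; apply: good_dist_gap => //.
  have := mean_dist_triangle nuP psi (phi i) (phi j).
  by rewrite (mean_distC _ (phi i) psi); lra.
have good_trans psi chi i : good psi -> dist psi chi < 1 / 3 ->
    dist chi (phi i) < 1 / 3 -> dist psi (phi i) < 1 / 3.
  move=> gpsi h1 h2; apply: good_dist_gap => //.
  by have := mean_dist_triangle nuP chi psi (phi i); lra.
have [a aP] : exists a : G -> 'I_k -> 'I_k,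
    forall g i, dist (translate g (phi i)) (phi (a g i)) < 1 / 3.
  have /choice[a aP] : forall gi : G * 'I_k, exists j,
      dist (translate gi.1 (phi gi.2)) (phi j) < 1 / 3.
    by move=> [g i]; apply: phiP; exact: good_translate.
  by exists (fun g i => a (g, i)) => g i; exact: aP (g, i).
pose v x := [pick i | dist (slice x) (phi i) < 1 / 3].
have vP x i : v x = Some i -> dist (slice x) (phi i) < 1 / 3.
  by rewrite /v; case: pickP => // j hj [<-].
have v_good x i : dist (slice x) (phi i) < 1 / 3 -> v x = Some i.
  rewrite /v; case: pickP => [j hj hi|/(_ i) -> //].
  by rewrite (eq_class _ _ _ hi hj).
exists k, a, v; split.
- exact: card_separated sphi.
(* Each law holds because both indices name a cluster close to the same translate, and such a
   cluster is unique. *)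
- split=> [i|g h i].
    apply: (eq_class (translate 1%g (phi i))); first exact: aP.
    by rewrite translate1 (mean_distxx nuP); lra.
  apply: (eq_class (translate (g * h)%g (phi i))); first exact: aP.
  rewrite translateM; apply: (good_trans _ _ _ _ _ (aP g (a h i))).
    by do 2!apply: good_translate.
  by rewrite (mean_dist_translate nuP).
- move=> x y i /vP hx /vP hy.
  apply: (@slice_uniq (1 / 3) (1 / 3) (phi i) (phi i)); last 2 first.
  + by rewrite (mean_distC nu).
  + by rewrite (mean_distC nu).
  + by rewrite (mean_distxx nuP); lra.
move=> g.
pose B := [pred x | 1 / 2 <= nu (bad_set x)].
pose C := [pred x | `[< bad_set x g >]].
(* An error at x forces x in B, [f g x] in B, or x in C. As [f g] is a permutation, the first two
   sets have equal size, and the total is 12c + 12c + 6c. *)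
have Bg : #|[pred x | f g x \in B]| = #|B|.
  transitivity #|preim (f g) B|; first exact: eq_card.
  rewrite (card_preim (@perm_inj _ (f g))); apply: eq_card => y.
  by rewrite inE -[y in y \in codom _](permKV (f g)) codom_f.
have : (#|[pred x | if v x is Some i then v (f g x) != Some (a g i) else true]|
    <= #|B| + #|[pred x | f g x \in B]| + #|C|)%N.
  have cardE (P : pred 'I_n) : #|P| = (\sum_x P x)%N.
    by rewrite -sum1_card big_mkcond; apply: eq_bigr => x _;
      rewrite unfold_in; case: (P x).
  rewrite !cardE -!big_split; apply: leq_sum => x _ /=.
  have le_b3 (p q r t : bool) :
      (~~ p -> ~~ q -> ~~ r -> t = false) -> (t <= p + q + r)%N.
    by case: p q r t => [] [] [] [] // ->.
  apply: le_b3; rewrite !inE.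
  rewrite -!ltNge => xB fxB /asboolP/negP; rewrite -ltNge => xC.
  have [i hi] := phiP _ (good_slice xB).
  rewrite (v_good _ _ hi) (v_good _ (a g i)) ?eqxx //.
  apply: (good_trans _ (translate g (phi i))); first exact: good_slice.
    (* The triangle inequality gives only 1/6 + 1/3, which the gap reduces to below 1/3. *)
    apply: good_dist_gap; [exact: good_slice|exact: good_translate|].
    have := mean_dist_triangle nuP (translate g (slice x)) (slice (f g x))
      (translate g (phi i)).
    by rewrite (mean_dist_translate nuP) (mean_distC nu _ (translate g (slice x))); lra.
  exact: aP.
rewrite Bg -(ler_nat R) !natrD => /le_trans; apply.
by have := card_bad; have := card_bad_set g; rewrite -/B -/C; lra.
Qed.

End Clusters.

(** * From an action on clusters to permutations extending the labels *)

Lemma perm_extension (T : finType) (r : seq T) (u : T -> T) :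
  {in r &, injective u} -> exists s : {perm T}, {in r, s =1 u}.
Proof.
elim: r => [_|x r IHr u_inj]; first by exists 1%g.
have [|s sP] := IHr; first by apply: sub_in2 u_inj => z; rewrite in_cons orbC => ->.
have [xr|xr] := boolP (x \in r).
  by exists s => z; rewrite in_cons => /orP[/eqP ->|]; exact: sP.
(* The transposition fixes the values already prescribed: none of them is [s x], by injectivity of
   s, or [u x], by injectivity of u. *)
exists (s * tperm (s x) (u x))%g => z; rewrite in_cons permM.
case: (eqVneq z x) => [-> _|zx /= zr]; first by rewrite tpermL.
rewrite (sP z zr) tpermD //; first by rewrite -(sP z zr) (inj_eq perm_inj) eq_sym.
by apply: contra_neq zx => /esym; apply: u_inj; rewrite in_cons ?eqxx ?zr ?orbT.
Qed.

Section Relabel.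
Variables (G : groupType) (n k N : nat) (le_nN : (n <= N)%N) (le_kN : (k <= N)%N).
Variable a : G -> 'I_k -> 'I_k.
Hypotheses (a1 : a 1%g =1 id) (aM : forall g h, a (g * h)%g =1 a g \o a h).

Definition pad (g : G) (z : 'I_N) : 'I_N :=
  if insub (z : nat) is Some i then widen_ord le_kN (a g i) else z.

Lemma pad_widen g i : pad g (widen_ord le_kN i) = widen_ord le_kN (a g i).
Proof. by rewrite /pad (valK i). Qed.

Lemma padM g h z : pad (g * h)%g z = pad g (pad h z).
Proof.
rewrite {1 3}/pad; case: insubP => [i _ iz|/negPf nz].
  by rewrite pad_widen aM.
by rewrite /pad insubN // nz.
Qed.

Lemma pad1 z : pad 1%g z = z.
Proof.
rewrite /pad; case: insubP => // i _ iz.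
by apply: val_inj; rewrite /= a1.
Qed.

(** The padded action is conjugated by a permutation p that carries each x having a cluster to that
    cluster's index; p exists because v is injective where defined. *)
Lemma relabel_action (v : 'I_n -> option 'I_k) :
  (forall x y i, v x = Some i -> v y = Some i -> x = y) ->
  exists h : G -> 'S_N, (forall g g', h (g * g')%g = perm_comp (h g) (h g')) /\
    forall g x y i, v x = Some i -> v y = Some (a g i) ->
      h g (widen_ord le_nN x) = widen_ord le_nN y.
Proof.
move=> v_inj.
pose u (z : 'I_N) : 'I_N := if insub (z : nat) is Some x then
  (if v x is Some i then widen_ord le_kN i else z) else z.
have uP x i : v x = Some i -> u (widen_ord le_nN x) = widen_ord le_kN i.
  by rewrite /u (valK x) => ->.
have [|p pP] := @perm_extension _ [seq widen_ord le_nN x | x <- enum 'I_n & v x] u.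
  move=> _ _ /mapP[x + ->] /mapP[y + ->]; rewrite !mem_filter.
  case vx: (v x) => [i|] //; case vy: (v y) => [j|] // _ _.
  rewrite (uP _ _ vx) (uP _ _ vy) => /(congr1 val) /= /val_inj ij.
  by congr widen_ord; apply: v_inj vx _; rewrite ij.
have pw x i : v x = Some i -> p (widen_ord le_nN x) = widen_ord le_kN i.
  move=> vx; rewrite pP ?(uP _ _ vx) //; apply: map_f.
  by rewrite mem_filter vx mem_enum.
pose act g z := (p^-1)%g (pad g (p z)).
have actM g h z : act (g * h)%g z = act g (act h z) by rewrite /act permKV padM.
have act_inj g : injective (act g).
  apply: (can_inj (g := act g^-1%g)) => z.
  by rewrite -actM mulVg /act pad1 permK.
exists (fun g => perm (@act_inj g)); split=> [g h|g x y i vx vy].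
  by apply/permP => z; rewrite perm_compE !permE actM.
by rewrite permE /act (pw _ _ vx) pad_widen -(pw _ _ vy) permK.
Qed.

End Relabel.

(** This is the case of trivial Delta, with counts in place of distances. Taking N = max(n, k)
    leaves room for both points and clusters. *)
Lemma approximating_homomorphism (R : realType) (G : groupType) (n : nat)
    (f : G -> 'S_n) (c : R) : (0 < n)%N -> amenable R G ->
  (forall a b, #|[pred x | f (a * b)%g x != perm_comp (f a) (f b) x]|%:R <= c) ->
  exists (N : nat) (le_nN : (n <= N)%N) (h : G -> 'S_N),
    [/\ N%:R <= n%:R + 12 * c,
        forall a b, h (a * b)%g = perm_comp (h a) (h b) &
        forall g, #|[pred x | widen_ord le_nN (f g x) != h g (widen_ord le_nN x)]|%:R
          <= 30 * c].
Proof.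
move=> n_gt0 /amenable_right_invariant_mean[nu nuP] fc.
have {}fc a b : #|[pred x | f (a * b)%g x != f a (f b x)]|%:R <= c.
  by apply: le_trans (fc a b); rewrite (eq_card (B := [pred x | f (a * b)%g x !=
    perm_comp (f a) (f b) x])) // => x; rewrite !inE perm_compE.
have c0 : 0 <= c by apply: le_trans (fc 1%g 1%g).
have [k [a [v [kn [a1 aM] v_inj vc]]]] := exists_approximating_action nuP n_gt0 fc.
have [h [hM hv]] := relabel_action (leq_maxl n k) (leq_maxr n k) a1 aM v_inj.
exists (maxn n k), (leq_maxl n k), h; split=> // [|g].
  by case: (leqP n k) => _ //; lra.
apply: le_trans (vc g); rewrite ler_nat; apply: subset_leq_card.
apply/fintype.subsetP => x; rewrite !inE; apply: contraR.
case vx: (v x) => [i|] //; rewrite negbK => /eqP vfx.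
by rewrite (hv g x (f g x) i) // eqxx.
Qed.

(** * Normalized Hamming distances and the reduction to the quotient *)

Section Hamming.
Variables (R : realType) (n : nat).
Hypothesis n_gt0 : (0 < n)%N.
Local Open Scope classical_set_scope.

Let n_pos : 0 < n%:R :> R. Proof. by rewrite ltr0n. Qed.

Lemma dH_samesize (s t : 'S_n) :
  #|[pred x | s x != t x]|%:R = dH R (leqnn n) s t * n%:R.
Proof.
rewrite /dH subnn addr0 mulrC mulVKf ?gt_eqF //; congr (_%:R); apply: eq_card => x.
by rewrite !inE; congr (_ != t _); apply: val_inj.
Qed.

Lemma dH_samesize_le1 (s t : 'S_n) : dH R (leqnn n) s t <= 1.
Proof.
rewrite -(ler_pM2r n_pos) -dH_samesize mul1r ler_nat -[leqRHS]card_ord.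
exact: max_card.
Qed.

(** A real [sup] dominates its set only if that set is bounded above; here 1 is a bound. *)
Lemma mismatch_le_sup (I : Type) (D : set I) (s t : I -> 'S_n) i : D i ->
  #|[pred x | s i x != t i x]|%:R <=
    sup [set dH R (leqnn n) (s i) (t i) | i in D] * n%:R.
Proof.
move=> Di; rewrite dH_samesize ler_wpM2r ?ler0n //.
apply: ub_le_sup; last by exists i.
by exists 1 => _ [j _ <-]; exact: dH_samesize_le1.
Qed.

Lemma mismatch_triangle (t s u : 'S_n) :
  (#|[pred x | s x != u x]| <= #|[pred x | s x != t x]| + #|[pred x | t x != u x]|)%N.
Proof.
rewrite -cardUI; apply: leq_trans (leq_addr _ _); apply: subset_leq_card.
apply/fintype.subsetP => x; rewrite !inE.
by case: (eqVneq (s x) (t x)) => [->|].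
Qed.

End Hamming.

Theorem theorem2p20 (R : realType) (Gamma : groupType) (n : nat)
    (n_gt0 : (0 < n)%N) (f : Gamma -> 'S_n)
    (Delta : {pred Gamma}) (nDelta : normal_subgroup Delta)
    (amen : amenable R (factor_group nDelta)) :
  let delta_infty : R := def_infty R f in
  let delta_Delta : R := dist_id_on R Delta f in
  exists (N : nat) (le_nN : (n <= N)%N) (h : Gamma -> 'S_N),
    [/\ N%:R <= (1 + 2436 * delta_infty + 1218 * delta_Delta) * n%:R,
        forall x y : Gamma, h (x * y)%g = perm_comp (h x) (h y) &
        d_infty R le_nN f h <= 4079 * delta_infty + 2040 * delta_Delta].
Proof.
move=> di dD.
have fM a b : #|[pred x | f (a * b)%g x != perm_comp (f a) (f b) x]|%:R <= di * n%:R.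
  exact: (@mismatch_le_sup R n n_gt0 _ setT (fun p => f (p.1 * p.2)%g)
    (fun p => perm_comp (f p.1) (f p.2)) (a, b)).
have fD t : t \in Delta -> #|[pred x | f t x != (1%g : 'S_n) x]|%:R <= dD * n%:R.
  by apply: (@mismatch_le_sup R n n_gt0 _ [set` Delta]%classic f (fun=> 1%g)).
have fMr s t : t \in Delta ->
    #|[pred x | f s x != f (s * t)%g x]|%:R <= (di + dD) * n%:R.
  move=> /fD; have := fM s t.
  have : (#|[pred x | f s x != f (s * t)%g x]| <=
    #|[pred x | f (s * t)%g x != perm_comp (f s) (f t) x]| +
    #|[pred x | f t x != (1%g : 'S_n) x]|)%N.
    rewrite -cardUI; apply: leq_trans (leq_addr _ _); apply: subset_leq_card.
    apply/fintype.subsetP => x; rewrite !inE perm_compE perm1.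
    by case: (eqVneq (f t x) x) => [->|]; rewrite ?orbT // eq_sym => ->.
  by rewrite -(ler_nat R) natrD mulrDl; lra.
pose s (a : factor_group nDelta) : Gamma := generic_quotient.repr a.
pose cl := (generic_quotient.pi (factor_group nDelta)).
have sP x : exists2 t, t \in Delta & x = (s (cl x) * t)%g.
  exists ((s (cl x))^-1 * x)%g; last by rewrite mulKVg.
  exact: (repr_factor nDelta x).
have sM a b : exists2 t, t \in Delta & (s a * s b = s (a * b) * t)%g.
  by have -> : (a * b)%g = cl (s a * s b)%g by []; exact: sP.
(* Replacing [s a * s b] by [s (a * b)] changes the argument by an element of Delta and costs di +
   dD; the defect of f costs another di. *)
pose c := (2 * di + dD) * n%:R.
have fsM a b :
    #|[pred x | f (s (a * b)%g) x != perm_comp (f (s a)) (f (s b)) x]|%:R <= c.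
  have [t tD sab] := sM a b.
  have := mismatch_triangle (f (s a * s b)%g) (f (s (a * b)%g))
    (perm_comp (f (s a)) (f (s b))).
  have := fMr (s (a * b)%g) t tD; have := fM (s a) (s b); rewrite -sab.
  by rewrite -(ler_nat R) natrD /c !mulrDl; lra.
have [N [le_nN [h [hN hM hf]]]] := approximating_homomorphism n_gt0 amen fsM.
have di0 : 0 <= di * n%:R by apply: le_trans (fM 1%g 1%g).
have dD0 : 0 <= dD * n%:R.
  by have [[D1 _] _] := nDelta; apply: le_trans (fD 1%g D1).
exists N, le_nN, (h \o cl); split.
- by rewrite /c in hN; lra.
- by move=> x y; rewrite /= -hM; congr h; rewrite [LHS]/cl -(factor_mulE nDelta).
apply: ge_sup => [|_ [g _ <-]]; first by eexists; exists 1%g.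
rewrite /dH mulrC ler_pdivrMr ?ltr0n ?(leq_trans n_gt0) //.
set B := (X in _ <= X * _).
have B0 : 0 <= B * n%:R by rewrite /B; lra.
(* The errors are estimated in multiples of n, whereas the distance is normalized by N >= n. *)
have : B * n%:R <= B * N%:R.
  by rewrite ler_wpM2l ?ler_nat // -(pmulr_lge0 _ (_ : 0 < n%:R)) ?ltr0n.
apply: le_trans.
(* The count is at most (di + dD) n for passing to the representative, plus 30c, plus 12c for N - n:
   in all (85 di + 43 dD) n, well within B n. *)
have := hf (cl g); rewrite natrB //; move: hN; rewrite /c /B.
have [t tD gt] := sP g.
have := fMr (s (cl g)) t tD; rewrite -gt.
have : (#|[pred x | widen_ord le_nN (f g x) != h (cl g) (widen_ord le_nN x)]| <=
  #|[pred x | f (s (cl g)) x != f g x]| +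
  #|[pred x | widen_ord le_nN (f (s (cl g)) x) != h (cl g) (widen_ord le_nN x)]|)%N.
  rewrite -cardUI; apply: leq_trans (leq_addr _ _); apply: subset_leq_card.
  apply/fintype.subsetP => x; rewrite !inE.
  by case: (eqVneq (f (s (cl g)) x) (f g x)) => [->|].
by rewrite -(ler_nat R) natrD /=; lra.
Qed.
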